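(* Let $S\ne\mathbb{N}$ be a numerical semigroup. For every $s\in S\setminus\{0\}$, $$t(S)\;\le\;\sum_{p\in\mathrm{Min}\,Q_s(S)}\bigl|\{f\in\mathrm{PF}(S):\ f+s-p\in S\}\bigr|.$$
   Context: $\mathbb{N}=\{0,1,2,\dots\}$. A numerical semigroup is a submonoid $S\subseteq\mathbb{N}$ (under addition) with finite complement. An integer $f$ is a pseudo-Frobenius number of $S$ if $f\notin S$ and $f+s\in S$ for all $s\in S\setminus\{0\}$; $\mathrm{PF}(S)$ is the set of these and $t(S)=|\mathrm{PF}(S)|$. On $\mathbb{Z}$ consider the partial order $a\preceq_S b\iff b-a\in S$. For $s\in S\setminus\{0\}$, $\mathrm{Ap}(S,s)=\{u\in S: u-s\notin S\}$ and $Q_s(S)$ is the poset $(\mathrm{Ap}(S,s)\setminus\{0\},\preceq_S)$; $\mathrm{Min}\,Q_s(S)$ is its set of minimal elements. *)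

(* Defs.v *)
From mathcomp Require Import all_boot all_order all_algebra finmap.
From mathcomp Require Import boolp classical_sets functions cardinality fsbigop.
From mathcomp Require Import zify.

Set Implicit Arguments.
Unset Strict Implicit.
Unset Printing Implicit Defensive.

Import Order.TTheory GRing.Theory Num.Theory.
Local Open Scope classical_set_scope.
Local Open Scope ring_scope.

Definition numerical_semigroup (S : set nat) : Prop :=
  [/\ S 0%N, (forall a b : nat, S a -> S b -> S (a + b)%N)
    & finite_set (~` S)].

(* S as a subset of the integers, so that differences are not truncated. *)
Definition intset (S : set nat) : set int := Posz @` S.

Definition PF (S : set nat) : set int :=
  [set f | ~ intset S f /\
           forall s : nat, S s -> s <> 0%N -> intset S (f + s%:Z)].

(* [fset_set A] is the finite set A, or fset0 if A is infinite; PF S is finite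
   for a numerical semigroup S, see [finite_PF] below. *)
Definition semigroup_type (S : set nat) : nat := #|` fset_set (PF S)|.

Definition sg_le (S : set nat) (a b : int) : Prop := intset S (b - a).

Definition Ap (S : set nat) (s : nat) : set int :=
  [set u | intset S u /\ ~ intset S (u - s%:Z)].

Definition Q (S : set nat) (s : nat) : set int := Ap S s `\ 0.

Definition minimal_elements (T : Type) (le : T -> T -> Prop) (A : set T) :
  set T := [set p | A p /\ forall q, A q -> le q p -> q = p].

Definition MinQ (S : set nat) (s : nat) : set int :=
  minimal_elements (sg_le S) (Q S s).

Lemma intsetE (S : set nat) (n : nat) : intset S n%:Z = S n.
Proof. by apply/propext; split=> [[m Sm [<-]]//|Sn]; exists n. Qed.

Lemma sg_le_refl (S : set nat) (a : int) :
  numerical_semigroup S -> sg_le S a a.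
Proof. by case=> S0 _ _; rewrite /sg_le subrr (intsetE S 0). Qed.

Lemma sg_le_trans (S : set nat) (a b c : int) :
  numerical_semigroup S -> sg_le S a b -> sg_le S b c -> sg_le S a c.
Proof.
case=> _ SD _ [m Sm mE] [n Sn nE]; exists (m + n)%N; first exact: SD.
lia.
Qed.

Lemma sg_le_anti (S : set nat) (a b : int) :
  sg_le S a b -> sg_le S b a -> a = b.
Proof. by move=> [m _ mE] [n _ nE]; lia. Qed.

Lemma conductor_exists (S : set nat) : numerical_semigroup S ->
  exists c : nat, forall n : nat, (c <= n)%N -> S n.
Proof.
case=> _ _ /finite_fsetP[F FE].
exists (\max_(x <- enum_fset F) x).+1 => n cn.
apply: contrapT => nSn.
have nF : n \in F by have : (~` S) n by []; rewrite FE.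
have := @leq_bigmax_seq _ (enum_fset F) xpredT id n nF isT.
by rewrite leqNgt cn.
Qed.

Lemma finite_int_bounded (A : set int) (m n : nat) :
  (forall x, A x -> - m%:Z <= x < n%:Z) -> finite_set A.
Proof.
move=> bA.
apply: (@sub_finite_set _ _ ((fun k : nat => k%:Z - m%:Z) @` `I_(m + n))).
  move=> x /bA /andP[lx xn]; exists (absz (x + m%:Z)) => /=; lia.
exact/finite_image/finite_II.
Qed.

Lemma finite_PF (S : set nat) : numerical_semigroup S -> finite_set (PF S).
Proof.
move=> /conductor_exists[c cS].
apply: (@finite_int_bounded _ c.+1 c) => f [nSf fS].
have [n _ nE] := fS c.+1 (cS _ (leqnSn c)) ltac:(by []).
have [cf|] := leP c%:Z f; last lia.
by exfalso; apply: nSf; exists (absz f); [apply: cS; lia|lia].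
Qed.

Lemma finite_MinQ (S : set nat) (s : nat) :
  numerical_semigroup S -> finite_set (MinQ S s).
Proof.
move=> /conductor_exists[c cS].
apply: (@finite_int_bounded _ 0 (c + s)) => p [[[[n _ nE] nS] _] _].
have [cp|] := leP (c + s)%:Z p; last lia.
by exfalso; apply: nS; exists (absz (p - s%:Z)); [apply: cS; lia|lia].
Qed.

(* Main.v *)
Require Import Defs.
From mathcomp Require Import all_boot all_order all_algebra finmap.
From mathcomp Require Import boolp classical_sets functions cardinality fsbigop.
From mathcomp Require Import zify.

Set Implicit Arguments.
Unset Strict Implicit.

Import Order.TTheory GRing.Theory Num.Theory.

(* If f is pseudo-Frobenius then f + s lies in Q_s(S), so it is above some
   minimal element p; hence PF(S) is the union over p of the sets on the right,
   and the bound is subadditivity of cardinality. *)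

Local Open Scope classical_set_scope.
Local Open Scope ring_scope.

(** Union bound. Finiteness guards against default values: [fset_set] of an infinite set is empty,
    and a sum with infinite support is 0. *)
Lemma card_fset_set_bigcup_le (I T : choiceType) (A : set I) (B : set T)
    (F : I -> set T) :
  finite_set A -> (forall i, A i -> finite_set (F i)) ->
  B `<=` \bigcup_(i in A) F i ->
  (#|` fset_set B| <= \big[addn/0%N]_(i \in A) #|` fset_set (F i)|)%N.
Proof.
move=> finA finF BF.
have finB : finite_set B by apply: (sub_finite_set BF); apply: bigcup_finite.
rewrite fsbig_finite //=.
apply: (@leq_trans #|` \bigcup_(i <- fset_set A) fset_set (F i)|%fset).
  apply/fsubset_leq_card/fsubsetP => x.
  rewrite in_fset_set // inE => /BF[i Ai Fix].
  apply/bigfcupP; exists i; first by rewrite andbT in_fset_set // inE.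
  by rewrite in_fset_set ?inE //; exact: finF.
(* Union and sum are built up in parallel, keeping the cardinality of the first at most the
   second. *)
elim/big_ind2: _ => [|U m V n Um Vn|//]; first by rewrite cardfs0.
by rewrite cardfsU; lia.
Qed.

(* If -s were pseudo-Frobenius, S would be stable under subtracting s, and
   subtracting it repeatedly from large integers would give S = N. *)
Lemma PF_neq_opp (S : set nat) (s : nat) (f : int) :
  numerical_semigroup S -> S <> setT -> s <> 0%N -> PF S f -> f + s%:Z <> 0.
Proof.
move=> hS hSN s_neq0 [_ fS] fs0; apply: hSN; apply/seteqP; split=> // n _.
have subs m : S (m + s)%N -> S m.
  move=> Sms; rewrite -intsetE (_ : m%:Z = f + (m + s)%N%:Z); last by lia.
  by apply: fS => //; lia.
have [c cS] := conductor_exists hS.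
(* Since [s >= 1], [n + c * s] is at least [c]; then [s] is subtracted [c] times. *)
have: S (n + c * s)%N by apply: cS; nia.
elim: c {cS} => [|c IH]; first by rewrite mul0n addn0.
by rewrite mulSnr addnA => /subs.
Qed.

Lemma PF_shift_Q (S : set nat) (s : nat) (f : int) :
  numerical_semigroup S -> S <> setT -> S s -> s <> 0%N -> PF S f ->
  Q S s (f + s%:Z).
Proof.
move=> hS hSN Ss s_neq0 PFf; case: (PFf) => nSf fS.
split; last exact: (PF_neq_opp hS hSN s_neq0 PFf).
by split; [exact: fS | rewrite addrK].
Qed.

(** Descent on the absolute value: elements of [Q S s] are nonnegative, so passing to one strictly
    below [u] makes it drop. *)
Lemma exists_minQ_le (S : set nat) (s : nat) (u : int) :
  numerical_semigroup S -> Q S s u -> exists2 p, MinQ S s p & sg_le S p u.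
Proof.
move=> hS; have [n] := ubnP `|u|%N; elim: n u => // n IH u ltun Qu.
have [uMin|] := pselect (MinQ S s u).
  by exists u => //; exact: sg_le_refl.
move=> /not_andP[//|/existsNP[q /not_implyP[Qq /not_implyP[lequ neq]]]].
have ltqu : (`|q| < `|u|)%N.
  by case: Qq Qu lequ => [[[a _ aE] _] _] [[[b _ bE] _] _] [d _ dE]; lia.
have [p Mp leqp] := IH q (leq_trans ltqu ltun) Qq.
by exists p => //; exact: sg_le_trans leqp lequ.
Qed.

Theorem proposition4p2 (S : set nat) (hS : numerical_semigroup S)
    (hSN : S <> setT) (s : nat) (Ss : S s) (s_neq0 : s <> 0%N) :
  (semigroup_type S <=
   \big[addn/0%N]_(p \in MinQ S s)
     #|` fset_set [set f : int | PF S f /\ intset S (f + s%:Z - p)%R]|)%N.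
Proof.
apply: card_fset_set_bigcup_le.
- exact: finite_MinQ.
- by move=> p _; apply: sub_finite_set (finite_PF hS) => f [].
- move=> f PFf; have Qfs := PF_shift_Q hS hSN Ss s_neq0 PFf.
  (* [sg_le S p (f + s%:Z)] unfolds to the membership that defines the set indexed by [p]. *)
  by have [p Mp lep] := exists_minQ_le hS Qfs; exists p.
Qed.
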